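(* Let $\mathcal{X}$ be an Artin spherical group with classical generators $x_1,\dots,x_n$, and let $\Delta$ be its Garside element. Consider $\mathcal{X}$ as a monoid generated by $\{x_1,\dots,x_n,\nabla\}$ where $\nabla=\Delta^{-1}$, and let $g_k$ be the number of elements of $\mathcal{X}$ whose word length with respect to this monoid generating set equals $k$. Then $(g_k)$ has growth rate less than $4$, i.e. $\limsup_k g_k^{1/k}<4$.
   Context: An Artin spherical group is the group given by the presentation $\langle x_1,\dots,x_n\mid x_ix_jx_i\cdots=x_jx_ix_j\cdots$ (both sides of length $r_{ij}$, for $r_{ij}<\infty$)$\rangle$ where the labels $r_{ij}$ come from a finite Coxeter graph whose connected components are of type $A_n$ ($n\ge1$), $B_n$ ($n\ge2$), $D_n$ ($n\ge4$), $E_6,E_7,E_8$, $F_4$, $G_2$, $H_3$, $H_4$, or $I_2(p)$ ($p\ge5,p\ne6$) (the finite Coxeter groups' diagrams; $r_{ij}=2$ if no edge, $3$ for an unlabeled edge). The Garside element $\Delta$ is the least common (left) multiple of $x_1,\dots,x_n$ in the associated positive monoid $\mathcal{X}^+$ (the monoid with the same presentation). A sequence $(s_k)$ of positive numbers has growth rate less than $\gamma$ if $\limsup_k \exp(\log(s_k)/k)<\gamma$. *)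

(* Defs.v *)
From mathcomp Require Import all_boot all_order all_algebra.
From mathcomp Require Import all_classical all_reals all_analysis.
From mathcomp Require Import Rstruct Rstruct_topology.

Set Implicit Arguments.
Unset Strict Implicit.
Unset Printing Implicit Defensive.

Import Order.TTheory GRing.Theory Num.Theory.


(* Coxeter matrices.  A Coxeter "matrix" on 'I_n is m : 'I_n -> 'I_n -> nat; *)
(* for i != j, m i j is the label r_ij (2 = no edge, 3 = unlabeled edge,   *)
(* 0 stands for infinity).  Diagonal entries are irrelevant.              *)

Definition path_lab (a : nat) (i j : nat) : nat :=
  if (i == j.+1) || (j == i.+1) then (if minn i j == 0 then a else 3) else 2.

Definition typeA (k : nat) (i j : nat) : nat := path_lab 3 i j.
Definition typeB (k : nat) (i j : nat) : nat := path_lab 4 i j.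
Definition typeD (k : nat) (i j : nat) : nat :=
  if (i == k.-1) || (j == k.-1) then
    (if (i == k - 3) || (j == k - 3) then 3 else 2)
  else path_lab 3 i j.
Definition typeE (k : nat) (i j : nat) : nat :=
  if (i == k.-1) || (j == k.-1) then
    (if (i == 2) || (j == 2) then 3 else 2)
  else path_lab 3 i j.
Definition typeF4 (i j : nat) : nat :=
  if ((i == 1) && (j == 2)) || ((i == 2) && (j == 1)) then 4 else path_lab 3 i j.
Definition typeH (i j : nat) : nat := path_lab 5 i j.
(* I2(p) (and G2 = I2(6)) : two vertices joined by an edge labelled p *)
Definition typeI (p : nat) (i j : nat) : nat := path_lab p i j.

Definition finite_conn_diagram (k : nat) (M : nat -> nat -> nat) : Prop :=
     ((1 <= k)%N /\ M = typeA k)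
  \/ ((2 <= k)%N /\ M = typeB k)
  \/ ((4 <= k)%N /\ M = typeD k)
  \/ ((k \in [:: 6; 7; 8]%N) /\ M = typeE k)
  \/ (k = 4%N /\ M = typeF4)
  \/ (k = 2%N /\ M = typeI 6)
  \/ ((k = 3%N \/ k = 4%N) /\ M = typeH)
  \/ (k = 2%N /\ exists p, [/\ (5 <= p)%N, p != 6%N & M = typeI p]).

(* m is spherical: its Coxeter graph is a disjoint union of connected      *)
(* components (labelled by c), each isomorphic (via f) to a finite          *)
(* connected Coxeter diagram from the list above.                           *)
Definition spherical (n : nat) (m : 'I_n -> 'I_n -> nat) : Prop :=
  exists (p : nat) (c : 'I_n -> 'I_p),
    (forall i j, c i != c j -> m i j = 2%N) /\
    forall q : 'I_p, exists (k : nat) (f : 'I_k -> 'I_n) (M : nat -> nat -> nat),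
      [/\ injective f,
          (forall i, c i = q <-> exists a, f a = i),
          finite_conn_diagram k M &
          forall a b : 'I_k, a != b -> m (f a) (f b) = M a b].

(* Words.  A group letter is (i, false) = x_i or (i, true) = x_i^{-1}.     *)

Definition gletter (n : nat) := ('I_n * bool)%type.
Definition gword (n : nat) := seq (gletter n).

Definition ginv_letter n (a : gletter n) : gletter n := (a.1, ~~ a.2).
Definition ginv n (w : gword n) : gword n := rev (map (@ginv_letter n) w).

Fixpoint alt n (i j : 'I_n) (r : nat) : seq 'I_n :=
  if r is r'.+1 then i :: alt j i r' else [::].

Definition pos (n : nat) (u : seq 'I_n) : gword n := map (fun i => (i, false)) u.

Inductive artin_rel n (m : 'I_n -> 'I_n -> nat) : seq 'I_n -> seq 'I_n -> Prop :=
| ArtinRel i j : i != j -> (0 < m i j)%N -> artin_rel m (alt i j (m i j)) (alt j i (m i j)).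

Inductive group_move n (m : 'I_n -> 'I_n -> nat) : gword n -> gword n -> Prop :=
| GCancel (a : gletter n) : group_move m [:: a; ginv_letter a] [::]
| GRel u v : artin_rel m u v -> group_move m (pos u) (pos v).

Inductive group_eq n (m : 'I_n -> 'I_n -> nat) : gword n -> gword n -> Prop :=
| GE_refl w : group_eq m w w
| GE_sym w w' : group_eq m w w' -> group_eq m w' w
| GE_trans w1 w2 w3 : group_eq m w1 w2 -> group_eq m w2 w3 -> group_eq m w1 w3
| GE_ctx (u v w w' : gword n) : group_move m w w' -> group_eq m (u ++ w ++ v) (u ++ w' ++ v).

Inductive monoid_eq n (m : 'I_n -> 'I_n -> nat) : seq 'I_n -> seq 'I_n -> Prop :=
| ME_refl w : monoid_eq m w w
| ME_sym w w' : monoid_eq m w w' -> monoid_eq m w' w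
| ME_trans w1 w2 w3 : monoid_eq m w1 w2 -> monoid_eq m w2 w3 -> monoid_eq m w1 w3
| ME_ctx (u v w w' : seq 'I_n) : artin_rel m w w' -> monoid_eq m (u ++ w ++ v) (u ++ w' ++ v).

Definition common_left_multiple n (m : 'I_n -> 'I_n -> nat) (D : seq 'I_n) : Prop :=
  forall i : 'I_n, exists c, monoid_eq m D (rcons c i).

Definition is_garside n (m : 'I_n -> 'I_n -> nat) (D : seq 'I_n) : Prop :=
  common_left_multiple m D /\
  forall E, common_left_multiple m E -> exists c, monoid_eq m E (c ++ D).

(* Monoid generating set {x_1, ..., x_n, nabla}, nabla = Delta^{-1}.       *)
(* A letter a : 'I_n.+1 is x_a if a < n, and nabla if a = n.                *)

Definition eval_letter n (D : seq 'I_n) (a : 'I_n.+1) : gword n :=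
  match insub (nat_of_ord a) : option 'I_n with
  | Some i => [:: (i, false)]
  | None => ginv (pos D)
  end.

Definition eval_word n (D : seq 'I_n) (w : seq 'I_n.+1) : gword n :=
  flatten (map (@eval_letter n D) w).

Definition geodesic n (m : 'I_n -> 'I_n -> nat) (D : seq 'I_n) (w : seq 'I_n.+1) : Prop :=
  forall w' : seq 'I_n.+1, (size w' < size w)%N ->
    ~ group_eq m (eval_word D w') (eval_word D w).

(* g_k = number of elements of X of word length exactly k: the number of   *)
(* classes (for equality in X) of geodesic words of length k.               *)
Definition growth_count n (m : 'I_n -> 'I_n -> nat) (D : seq 'I_n) (k : nat) : nat :=
  #| (fun w : k.-tuple 'I_n.+1 =>
        [set w' : k.-tuple 'I_n.+1 |
           `[< group_eq m (eval_word D w) (eval_word D w') >]])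
     @: [set w : k.-tuple 'I_n.+1 | `[< geodesic m D w >]] |.

Local Open Scope ring_scope.
Definition growth_rate (s : nat -> nat) : \bar Rdefinitions.R :=
  limn_esup (fun k => ((expR (ln (s k)%:R / k%:R)) : Rdefinitions.R)%:E).

(* Main.v *)
Require Import Defs.
From mathcomp Require Import all_boot all_order all_algebra.
From mathcomp Require Import all_classical all_reals all_analysis.
From mathcomp Require Import Rstruct Rstruct_topology.
From mathcomp Require Import zify lra.

(** Deleting all relations but the commutations can only increase the number of
    positive elements. A positive word can be sorted so that no letter is followed by
    a commuting letter of smaller rank; the sorted words are the paths of a graph on
    the generators, and on each tree diagram there are explicit positive weights [y]
    with [sum_(i may follow j) y i < 4 * y j], so that the number of paths of length
    [k] is [O(g^k)] with [g < 4].

    The inverse [nabla] of the Garside element [D] only adds one more letter that sorts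
    before all others, because [D x_i = x_j D] for some [j]. Indeed [D] is divisible by
    the lcm of [x_i] and any [x_l], which right multiplication by [x_i] turns into
    [z * lcm]; hence [D x_i] is a common multiple of all generators, so a multiple of
    [D]. That two letters dividing a positive element have an lcm dividing it is
    Garside's reduction lemma, which amounts to a cube condition on triples of
    generators. *)

Set Implicit Arguments.
Unset Strict Implicit.
Unset Printing Implicit Defensive.

(** * Word reversing and Garside's reduction lemma *)

Section Reversing.

Variables (n : nat) (m : 'I_n -> 'I_n -> nat).
Implicit Types (a b c : 'I_n) (u v w X Y U V W : seq 'I_n).

Local Notation "u =~ v" := (monoid_eq m u v) (at level 70).

Lemma alt_size (i j : 'I_n) r : size (alt i j r) = r.
Proof. by elim: r i j => //= r IH i j; rewrite IH. Qed.

Lemma monoid_eq_size u v : u =~ v -> size u = size v.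
Proof.
elim=> // [u1 u2 u3 _ -> _ -> //|u1 v1 _ _ [i j _ _]].
by rewrite !size_cat !alt_size.
Qed.

Lemma monoid_eq_cat2l w u v : u =~ v -> w ++ u =~ w ++ v.
Proof.
elim=> [u1|u1 u2 _|u1 u2 u3 _ + _|u1 v1 u2 v2 r]; [exact: ME_refl|exact: ME_sym|exact: ME_trans|].
by rewrite catA [X in _ =~ X]catA; apply: ME_ctx.
Qed.

Lemma monoid_eq_cat2r w u v : u =~ v -> u ++ w =~ v ++ w.
Proof.
elim=> [u1|u1 u2 _|u1 u2 u3 _ + _|u1 v1 u2 v2 r]; [exact: ME_refl|exact: ME_sym|exact: ME_trans|].
by rewrite -!catA; apply: ME_ctx.
Qed.

Lemma monoid_eq_cons x u v : u =~ v -> x :: u =~ x :: v.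
Proof. exact: (@monoid_eq_cat2l [:: x]). Qed.

(* [a :: complement a b] is the candidate least common right multiple of [a] and [b]. *)
Definition complement a b : seq 'I_n :=
  if a == b then [::] else alt b a (m a b).-1.

Lemma complement_id a : complement a a = [::].
Proof. by rewrite /complement eqxx. Qed.

(* Word reversing: a result [Some (x, y)] exhibits the least common right
   multiple [u ++ x =~ v ++ y] of [u] and [v]. *)
Fixpoint reverse (f : nat) u v : option (seq 'I_n * seq 'I_n) :=
  if f isn't f'.+1 then None else
  match u, v with
  | [::], _ => Some (v, [::])
  | _, [::] => Some ([::], u)
  | a :: u, b :: v =>
      if reverse f' u (complement a b) is Some (x, u') then
        if reverse f' v (complement b a) is Some (y, v') then
          if reverse f' u' v' is Some (p, q) then Some (x ++ p, y ++ q)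
          else None
        else None
      else None
  end.

(** Tests that the lcm of [a], [b], [c], computed through [c], is a multiple of the lcm of [a] and
    [b]. The empty second components say that [complement a b] divides [complement a c ++ x] with
    quotient [p], and similarly [q] on the side of [b]; the last reversal says that [p] and [q] are
    equal. *)
Definition cube_check (f : nat) a b c : bool :=
  if reverse f (complement c a) (complement c b) is Some (x, y) then
    if reverse f (complement a b) (complement a c ++ x) is Some (p, [::]) then
      if reverse f (complement b a) (complement b c ++ y) is Some (q, [::]) then
        reverse f p q == Some ([::], [::])
      else false
    else false
  else false.

Hypothesis msym : forall i j, i != j -> m i j = m j i.
Hypothesis mge2 : forall i j, i != j -> 2 <= m i j.

Lemma alt_rel i j : i != j -> alt i j (m i j) =~ alt j i (m i j).
Proof.
move=> ij; have := @ME_ctx _ m [::] [::] _ _ (ArtinRel ij (ltnW (mge2 ij))).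
by rewrite /= !cats0.
Qed.

Lemma alt_complement a b : a != b -> a :: complement a b = alt a b (m a b).
Proof. by move=> ab; rewrite /complement (negPf ab); case: (m a b) (mge2 ab). Qed.

Lemma cons_complement a b : a :: complement a b =~ b :: complement b a.
Proof.
have [->|ab] := eqVneq a b; first exact: ME_refl.
have ba : b != a by rewrite eq_sym.
by rewrite !alt_complement // (msym ba); apply: alt_rel.
Qed.

Lemma reverse_sound f u v x y : reverse f u v = Some (x, y) -> u ++ x =~ v ++ y.
Proof.
elim: f u v x y => //= f IH [|a u] [|b v] x y; try by
  [case=> <- <- /=; rewrite ?cats0; apply: ME_refl].
case E1: reverse => [[x1 u1]|] //; case E2: reverse => [[y1 v1]|] //.
case E3: reverse => [[p q]|] // [<- <-] /=.
rewrite !catA.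
have h1 := monoid_eq_cons a (monoid_eq_cat2r p (IH _ _ _ _ E1)).
have h2 := monoid_eq_cons b (monoid_eq_cat2r q (IH _ _ _ _ E2)).
have h3 := monoid_eq_cat2l (b :: complement b a) (IH _ _ _ _ E3).
have h4 := monoid_eq_cat2r (u1 ++ p) (cons_complement a b).
apply: ME_trans h1 _; rewrite -catA; apply: ME_trans h4 _.
by apply: ME_trans h3 _; rewrite /= catA; apply: ME_sym.
Qed.

(** Garside's reduction lemma for words of length at most [k], the form that serves as induction
    hypothesis. *)
Definition reduction k := forall a b X Y, size X < k -> a :: X =~ b :: Y ->
  exists W, X =~ complement a b ++ W /\ Y =~ complement b a ++ W.

(** Each pair of leading letters met during reversing is resolved by [red], since only tails of the
    given common multiple occur and their length stays at most [k]. This is the minimality of the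
    computed common multiple. *)
Lemma reverse_complete k (red : reduction k) f u v x y U V :
  reverse f u v = Some (x, y) -> size (u ++ U) <= k -> u ++ U =~ v ++ V ->
  exists W, U =~ x ++ W /\ V =~ y ++ W.
Proof.
elim: f u v x y U V => //= f IH [|a u] [|b v] x y U V.
- by case=> <- <- _ h; exists V; split => //; apply: ME_refl.
- by case=> <- <- _ h; exists V; split => //; apply: ME_refl.
- by case=> <- <- _ h; exists U; split => //; [apply: ME_refl|apply: ME_sym].
case E1: reverse => [[x1 u1]|] //; case E2: reverse => [[y1 v1]|] //.
case E3: reverse => [[p q]|] // [<- <-] /= sz h.
have szv : size (v ++ V) < k by have := monoid_eq_size h => /= -[<-].
have [W [hu hv]] := red _ _ _ _ sz h.
have [W1 [hU hW1]] := IH _ _ _ _ _ _ E1 (ltnW sz) hu.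
have [W2 [hV hW2]] := IH _ _ _ _ _ _ E2 (ltnW szv) hv.
have sz1 : size (u1 ++ W1) <= k.
  rewrite -(monoid_eq_size hW1); have := monoid_eq_size hu.
  rewrite size_cat [RHS]size_cat; rewrite size_cat in sz; lia.
have [W3 [h1 h2]] := IH _ _ _ _ _ _ E3 sz1 (ME_trans (ME_sym hW1) hW2).
exists W3; rewrite -!catA; split.
  exact: ME_trans hU (monoid_eq_cat2l _ h1).
exact: ME_trans hV (monoid_eq_cat2l _ h2).
Qed.

(* What the transitivity step of the reduction lemma needs for [a X = c Z = b Y]. *)
Definition cube k a b c := forall U V, size (complement c a ++ U) <= k ->
  complement c a ++ U =~ complement c b ++ V ->
  exists W, complement a c ++ U =~ complement a b ++ W /\
            complement b c ++ V =~ complement b a ++ W.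

Lemma cube_sym k a b c : cube k a b c -> cube k b a c.
Proof.
move=> h U V sz e; have [|W [h1 h2]] := h V U _ (ME_sym e).
  by rewrite -(monoid_eq_size e).
by exists W.
Qed.

Lemma cube_check_sound k (red : reduction k) f a b c : cube_check f a b c -> cube k a b c.
Proof.
rewrite /cube_check; case E1: reverse => [[x y]|] //.
case E2: reverse => [[p [|? ?]]|] //; case E3: reverse => [[q [|? ?]]|] //.
move/eqP=> E4 U V sz h; have [W [hU hV]] := reverse_complete red E1 sz h.
have h2 := ME_sym (reverse_sound E2); have h3 := ME_sym (reverse_sound E3).
have h4 := reverse_sound E4; rewrite !cats0 in h2 h3 h4.
exists (p ++ W); split.
  apply: ME_trans (monoid_eq_cat2l _ hU) _.
  by rewrite !catA; apply: monoid_eq_cat2r.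
apply: ME_trans (monoid_eq_cat2l _ hV) _.
rewrite !catA; apply: monoid_eq_cat2r; apply: ME_trans h3 _.
exact: monoid_eq_cat2l (ME_sym h4).
Qed.

Lemma complement_comm a b : a != b -> m a b = 2 -> complement a b = [:: b].
Proof. by move=> ab h; rewrite /complement (negPf ab) h. Qed.

Lemma complement_commr a b : a != b -> m a b = 2 -> complement b a = [:: a].
Proof.
by move=> ab h; apply: complement_comm; rewrite -?(msym ab) // eq_sym.
Qed.

Lemma swap_comm a b u : a != b -> m a b = 2 -> a :: b :: u =~ b :: a :: u.
Proof.
move=> ab h; have := monoid_eq_cat2r u (cons_complement a b).
by rewrite (complement_comm ab h) (complement_commr ab h).
Qed.

Lemma comm_past a w u : all (fun x => (a != x) && (m a x == 2)) w ->
  a :: w ++ u =~ w ++ a :: u.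
Proof.
elim: w => [_|x w IH] /=; first exact: ME_refl.
case/andP=> /andP[ax /eqP mx] /IH h.
exact: ME_trans (swap_comm _ ax mx) (monoid_eq_cons x h).
Qed.

Lemma comm_split k (red : reduction k) a w U V :
  all (fun x => (a != x) && (m a x == 2)) w -> size U < k ->
  a :: U =~ w ++ V -> exists W, U =~ w ++ W /\ V =~ a :: W.
Proof.
elim: w U V => [|x w IH] U V /=.
  by move=> _ _ h; exists U; split; [apply: ME_refl|apply: ME_sym].
case/andP=> /andP[ax /eqP mx] hw sz h.
have [W1 [h1 h2]] := red _ _ _ _ sz h.
rewrite (complement_comm ax mx) in h1; rewrite (complement_commr ax mx) in h2.
have [|W [h3 h4]] := IH _ _ hw _ (ME_sym h2).
  by have := monoid_eq_size h1 => /= E; rewrite -ltnS -E ltnW.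
by exists W; split => //; apply: ME_trans h1 (monoid_eq_cons x h3).
Qed.

Lemma all_alt (P : pred 'I_n) i j r : P i -> P j -> all P (alt i j r).
Proof. by elim: r i j => //= r IH i j hi hj; rewrite hi IH. Qed.

Lemma all_complement (P : pred 'I_n) i j : P i -> P j -> all P (complement i j).
Proof. by move=> hi hj; rewrite /complement; case: ifP => // _; apply: all_alt. Qed.

(** The lcm of the triple is [c] times the lcm of [a] and [b], because [c] can be moved past both
    complements. *)
Lemma cube_comm_mid k (red : reduction k) a b c : c != a -> c != b ->
  m c a = 2 -> m c b = 2 -> cube k a b c.
Proof.
move=> ca cb ma mb U V; rewrite !(complement_comm ca, complement_comm cb) //.
rewrite !(complement_commr ca, complement_commr cb) //= => sz h.
have [W [h1 h2]] := red _ _ _ _ sz h; exists (c :: W); split.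
  apply: ME_trans (monoid_eq_cons c h1) _; apply: comm_past.
  by apply: all_complement; rewrite ?ca ?cb ?ma ?mb.
apply: ME_trans (monoid_eq_cons c h2) _; apply: comm_past.
by apply: all_complement; rewrite ?ca ?cb ?ma ?mb.
Qed.

Lemma cube_comm_end k (red : reduction k) a b c : a != b -> a != c ->
  m a b = 2 -> m a c = 2 -> cube k a b c.
Proof.
move=> ab ac mb mc U V; rewrite !(complement_comm ab, complement_comm ac) //.
rewrite !(complement_commr ab, complement_commr ac) //= => sz h.
have hcb : all (fun x => (a != x) && (m a x == 2)) (complement c b).
  by apply: all_complement; rewrite ?ab ?ac ?mb ?mc.
have hbc : all (fun x => (a != x) && (m a x == 2)) (complement b c).
  by apply: all_complement; rewrite ?ab ?ac ?mb ?mc.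
have [W [h1 h2]] := comm_split red hcb sz h.
exists (complement b c ++ W); split.
  apply: ME_trans (monoid_eq_cons c h1) _.
  exact: (monoid_eq_cat2r W (cons_complement c b)).
apply: ME_trans (monoid_eq_cat2l _ h2) _; apply: ME_sym; exact: comm_past.
Qed.

Lemma left_cancel k (red : reduction k) w U V :
  size (w ++ U) <= k -> w ++ U =~ w ++ V -> U =~ V.
Proof.
elim: w => //= x w IH sz /(red _ _ _ _ sz); rewrite complement_id => -[W [h1 h2]].
by apply: IH (ltnW sz) _; apply: ME_trans h1 (ME_sym h2).
Qed.

Hypothesis cubes : forall k a b c, reduction k -> uniq [:: a; b; c] -> cube k a b c.

Lemma cube_all k a b c : reduction k -> cube k a b c.
Proof.
move=> red; have [<-|ac] := eqVneq a c.
  by move=> U V _; rewrite !complement_id /= => h; exists V; split; [|apply: ME_refl].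
have [<-|bc] := eqVneq b c.
  move=> U V _; rewrite !complement_id /= => h; exists U; split; first exact: ME_refl.
  exact: ME_sym.
have [<-|ab] := eqVneq a b; last by apply: cubes => //=; rewrite !inE negb_or ab ac bc.
move=> U V sz /(left_cancel red sz) h; exists (complement a c ++ U).
rewrite complement_id; split; first exact: ME_refl.
exact: monoid_eq_cat2l (ME_sym h).
Qed.

(** The conclusion of the reduction lemma as a relation on whole words, fit for induction on a
    derivation of [u =~ v]. *)
Definition reduced_pair u v := match u, v with
  | a :: X, b :: Y => exists W, X =~ complement a b ++ W /\ Y =~ complement b a ++ W
  | [::], [::] => True
  | _, _ => False
  end.

(** Induction on the derivation. A single relation either starts at the first letter, giving the two
    complements, or leaves that letter alone. Transitivity through [c :: Z] is the cube condition,
    needed only for [Z], of length at most [k]. *)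
Lemma reduction_step k : reduction k -> reduction k.+1.
Proof.
move=> red.
suff H u v : u =~ v -> size u <= k.+1 -> reduced_pair u v.
  by move=> a b X Y sz /H; apply.
elim=> [[|a X] _|u1 u2 e IH sz|u1 u2 u3 e1 IH1 e2 IH2 sz|u1 v1 _ _ [i j ij m0]] //=.
- by exists X; rewrite complement_id; split; apply: ME_refl.
- move: IH; rewrite (monoid_eq_size e) => /(_ sz).
  by case: u1 {e} => [|a X]; case: u2 {sz} => [|b Y] //= [W [h1 h2]]; exists W.
- have s2 := sz; rewrite (monoid_eq_size e1) in s2.
  move: (IH1 sz) (IH2 s2) => {IH1 IH2 e1 e2}.
  case: u1 sz => [|a X] sz; case: u2 s2 => [|c Z] s2; case: u3 => [|b Y] //=.
  case=> U [h1 h2] [V [h3 h4]].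
  have szU : size (complement c a ++ U) <= k by rewrite -(monoid_eq_size h2).
  have [W [h5 h6]] := cube_all (b := b) red szU (ME_trans (ME_sym h2) h3).
  by exists W; split; [apply: ME_trans h1 h5|apply: ME_trans h4 h6].
- case: u1 => [|x u1] /= sz.
    rewrite -(alt_complement ij) (msym ij) -(@alt_complement j i) 1?eq_sym //=.
    by exists v1; split; apply: ME_refl.
  exists (u1 ++ alt j i (m i j) ++ v1); rewrite complement_id /=.
  by split; [apply: ME_ctx|apply: ME_refl].
Qed.

Lemma reductionT k : reduction k.
Proof. by elim: k => [a b X Y|k IH] //; apply: reduction_step. Qed.

Lemma lcm_factor a b X Y : a != b -> a :: X =~ b :: Y ->
  exists W, a :: X =~ alt a b (m a b) ++ W.
Proof.
move=> ab /(reductionT (ltnSn _))[W [h _]]; exists W.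
by rewrite -alt_complement //; apply: monoid_eq_cons.
Qed.

Lemma alt_rcons (i j : 'I_n) r : alt i j r.+1 = rcons (alt i j r) (if odd r then j else i).
Proof. by elim: r i j => // r IH i j; rewrite [LHS]/= -/(alt j i r.+1) IH /=; case: odd. Qed.

Lemma rev_alt (i j : 'I_n) r : rev (alt i j r) = if odd r then alt i j r else alt j i r.
Proof.
elim: r i j => // r IH i j.
by rewrite [in LHS]alt_rcons rev_rcons IH /=; case: (odd r).
Qed.

(** Reversal maps each defining relation to itself or its mirror image. It transfers facts on left
    divisors to the right divisors of [is_garside]. *)
Lemma monoid_eq_rev u v : u =~ v -> rev u =~ rev v.
Proof.
elim=> [u1|u1 u2 _|u1 u2 u3 _ + _|u1 v1 _ _ [i j ij _]];
  [exact: ME_refl|exact: ME_sym|exact: ME_trans|].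
rewrite !rev_cat -!catA; apply: monoid_eq_cat2l; apply: monoid_eq_cat2r.
by rewrite !rev_alt; case: odd; [|apply: ME_sym]; apply: alt_rel.
Qed.

(* If [D] is divisible by [i] and [j], it is divisible by their lcm [alt i j (m i j)],
   which right multiplication by [i] turns into [z * lcm] for a generator [z]. *)
Lemma garside_mul_common D i : is_garside m D -> common_left_multiple m (rcons D i).
Proof.
move=> [hD _] j; have [<-|ij] := eqVneq i j; first by exists D; apply: ME_refl.
have [ci /monoid_eq_rev] := hD i; have [cj /monoid_eq_rev] := hD j; rewrite !rev_rcons => hj hi.
have [W hW] := lcm_factor ij (ME_trans (ME_sym hi) hj).
have ji : j != i by rewrite eq_sym.
have : i :: rev D =~ alt j i (m i j) ++ ((if odd (m i j) then j else i) :: W).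
  apply: ME_trans (monoid_eq_cons i (ME_trans hi hW)) _.
  apply: ME_trans (monoid_eq_cons i (monoid_eq_cat2r W (alt_rel ij))) _.
  rewrite -cat_cons -/(alt i j (m i j).+1) alt_rcons cat_rcons.
  exact: monoid_eq_cat2r (alt_rel ij).
rewrite (msym ij) -(alt_complement ji) /= => /monoid_eq_rev.
by rewrite !rev_cons revK; eexists; eauto.
Qed.

(** The common multiple [rcons D i] equals some [c ++ D], and [c] is one letter because the
    relations preserve length. *)
Lemma garside_quasi_central D i : is_garside m D -> exists j, rcons D i =~ j :: D.
Proof.
move=> gD; have [c hc] := gD.2 _ (garside_mul_common i gD).
have := monoid_eq_size hc; rewrite size_rcons size_cat.
case: c hc => [|j [|j' c]] hc /= E; [lia|by exists j|lia].
Qed.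

End Reversing.

(** * The cube condition on triples of generators *)

Section Embedding.

Variables (p n : nat) (m' : 'I_p -> 'I_p -> nat) (m : 'I_n -> 'I_n -> nat).
Variable g : 'I_p -> 'I_n.
Hypothesis g_inj : injective g.
Hypothesis gm : forall i j, i != j -> m (g i) (g j) = m' i j.

Lemma map_alt i j r : map g (alt i j r) = alt (g i) (g j) r.
Proof. by elim: r i j => //= r IH i j; rewrite IH. Qed.

Lemma map_complement i j : map g (complement m' i j) = complement m (g i) (g j).
Proof.
rewrite /complement (inj_eq g_inj); have [//|ij] := eqVneq i j.
by rewrite map_alt gm.
Qed.

(** Reversing uses only the labels between the letters present, so a computation with three
    generators is valid in any larger set. *)
Lemma map_reverse f u v : reverse m f (map g u) (map g v) =
  omap (fun xy => (map g xy.1, map g xy.2)) (reverse m' f u v).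
Proof.
elim: f u v => //= f IH [|a u] [|b v] //=.
rewrite -!map_complement !IH; case: (reverse m' f u _) => [[x u']|] //=.
case: (reverse m' f v _) => [[y v']|] //=.
by rewrite IH; case: (reverse m' f u' _) => [[q r]|] //=; rewrite !map_cat.
Qed.

Lemma map_cube_check f a b c :
  cube_check m' f a b c -> cube_check m f (g a) (g b) (g c).
Proof.
rewrite /cube_check -!map_complement !map_reverse.
case: reverse => [[x y]|] //=; rewrite -!map_cat !map_reverse.
case: reverse => [[q [|? ?]]|] //=; rewrite -?map_cat ?map_reverse.
case: reverse => [[r [|? ?]]|] //=; rewrite ?map_reverse.
by move/eqP=> ->.
Qed.

End Embedding.

(* Labels of [A3], [B3] and [H3], in every order of the three vertices. *)
Definition connected_triples : seq (nat * nat * nat) :=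
  flatten [seq [:: (2, 3, l); (2, l, 3); (3, 2, l); (l, 2, 3); (3, l, 2); (l, 3, 2)]
          | l <- [:: 3; 4; 5]].

(** In the first three cases one vertex commutes with both others, and the remaining label is
    arbitrary. *)
Definition spherical_triple (p q r : nat) : bool :=
  [|| (p == 2) && (q == 2), (p == 2) && (r == 2), (q == 2) && (r == 2) |
      (p, q, r) \in connected_triples].

Definition triple_matrix (p q r : nat) (i j : 'I_3) : nat := nth 0 [:: p; q; r] (i + j).-1.

(** A finite computation, for which [20] is enough fuel. *)
Lemma triple_cube_check p q r : (p, q, r) \in connected_triples ->
  cube_check (triple_matrix p q r) 20
    (@Ordinal 3 0 isT) (@Ordinal 3 1 isT) (@Ordinal 3 2 isT).
Proof.
pose P (l : nat * nat * nat) := cube_check (triple_matrix l.1.1 l.1.2 l.2) 20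
  (@Ordinal 3 0 isT) (@Ordinal 3 1 isT) (@Ordinal 3 2 isT).
have /allP h : all P connected_triples by vm_compute.
exact: h.
Qed.

Section SphericalTriples.

Variables (n : nat) (m : 'I_n -> 'I_n -> nat).
Hypothesis msym : forall i j, i != j -> m i j = m j i.
Hypothesis mge2 : forall i j, i != j -> 2 <= m i j.
Hypothesis mtriple : forall a b c, uniq [:: a; b; c] -> spherical_triple (m a b) (m a c) (m b c).

Lemma spherical_cube k a b c : reduction m k -> uniq [:: a; b; c] -> cube m k a b c.
Proof.
move=> red abc; have := abc; rewrite /= !inE negb_or andbT => /andP[/andP[ab ac] bc].
have [ba ca cb] : [/\ b != a, c != a & c != b] by rewrite ![_ == a]eq_sym [c == b]eq_sym.
case/or4P: (mtriple abc) => [/andP[/eqP hb /eqP hc]|/andP[/eqP hb /eqP hc]|/andP[/eqP ha /eqP hb]|].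
- exact: cube_comm_end.
- by apply: cube_sym; apply: cube_comm_end; rewrite // -msym.
- by apply: cube_comm_mid; rewrite // -msym.
move/triple_cube_check; set l := triple_matrix _ _ _; pose g (i : 'I_3) := nth a [:: a; b; c] i.
have g_inj : injective g.
  by move=> i j /eqP; rewrite nth_uniq // => /eqP/val_inj.
have gm i j : i != j -> m (g i) (g j) = l i j.
  move=> ij; have : g i != g j by rewrite (inj_eq g_inj).
  by case: i j ij => [[|[|[|?]]] ?] [[|[|[|?]]] ?] //= _ gij;
     rewrite [LHS]msym // /l /triple_matrix /= /g /= msym.
by move/(map_cube_check g_inj gm); apply: cube_check_sound.
Qed.

Lemma artin_garside_quasi_central D i : is_garside m D ->
  exists j, monoid_eq m (rcons D i) (j :: D).
Proof. by apply: garside_quasi_central => // k a b c; apply: spherical_cube. Qed.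

End SphericalTriples.

(** * Labels and triples of vertices in the finite connected diagrams *)

Lemma path_labC a i j : path_lab a i j = path_lab a j i.
Proof. by rewrite /path_lab minnC orbC. Qed.

Lemma diagram_sym k M i j : finite_conn_diagram k M -> M i j = M j i.
Proof.
rewrite /finite_conn_diagram.
case=> [[_ ->]|[[_ ->]|[[_ ->]|[[_ ->]|[[_ ->]|[[_ ->]|[[_ ->]|[_ [p [_ _ ->]]]]]]]]]];
  try exact: path_labC.
- by rewrite /typeD path_labC (orbC (i == _)) (orbC (i == _)).
- by rewrite /typeE path_labC (orbC (i == k.-1)) (orbC (i == 2)).
- by rewrite /typeF4 path_labC orbC (andbC (i == 2)) (andbC (i == 1)).
Qed.

Lemma path_lab_ge2 a i j : 2 <= a -> 2 <= path_lab a i j.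
Proof. by rewrite /path_lab => ha; case: ifP => // _; case: ifP. Qed.

Lemma diagram_ge2 k M i j : finite_conn_diagram k M -> 2 <= M i j.
Proof.
rewrite /finite_conn_diagram.
case=> [[_ ->]|[[_ ->]|[[_ ->]|[[_ ->]|[[_ ->]|[[_ ->]|[[_ ->]|[_ [p [hp _ ->]]]]]]]]]];
  try exact: path_lab_ge2.
- by rewrite /typeD; case: ifP => _; [case: ifP|apply: path_lab_ge2].
- by rewrite /typeE; case: ifP => _; [case: ifP|apply: path_lab_ge2].
- by rewrite /typeF4; case: ifP => _ //; apply: path_lab_ge2.
- by apply: path_lab_ge2; lia.
Qed.

Variant path_lab_spec a i j : nat -> Prop :=
| PathFar of i != j.+1 & j != i.+1 : path_lab_spec a i j 2
| PathFirst of i + j = 1 : path_lab_spec a i j a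
| PathEdge of i = j.+1 \/ j = i.+1 & 1 < i + j : path_lab_spec a i j 3.

Lemma path_labP a i j : path_lab_spec a i j (path_lab a i j).
Proof.
rewrite /path_lab; case: ifP => h; last by constructor; lia.
by case: ifP => h'; constructor; lia.
Qed.

Lemma path_triple a i j l : a \in [:: 3; 4] -> i != j -> i != l -> j != l ->
  spherical_triple (path_lab a i j) (path_lab a i l) (path_lab a j l).
Proof.
move=> ha ij il jl.
by case: path_labP => *; case: path_labP => *; case: path_labP => * //;
  first [exfalso; lia | move: ha; rewrite !inE => /orP[] /eqP->].
Qed.

Lemma finite_triple k (M : nat -> nat -> nat) i j l :
  all (fun i => all (fun j => all (fun l => (i == j) || (i == l) || (j == l) ||
    spherical_triple (M i j) (M i l) (M j l)) (iota 0 k)) (iota 0 k)) (iota 0 k) ->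
  i < k -> j < k -> l < k -> i != j -> i != l -> j != l ->
  spherical_triple (M i j) (M i l) (M j l).
Proof.
move=> /allP h hi hj hl ij il jl.
have /h/allP/(_ j) : i \in iota 0 k by rewrite mem_iota.
rewrite mem_iota => /(_ hj)/allP/(_ l); rewrite mem_iota => /(_ hl).
by rewrite (negPf ij) (negPf il) (negPf jl).
Qed.

Lemma typeD_triple k i j l : 4 <= k -> i < k -> j < k -> l < k ->
  i != j -> i != l -> j != l ->
  spherical_triple (typeD k i j) (typeD k i l) (typeD k j l).
Proof.
move=> hk hi hj hl ij il jl; rewrite /typeD.
have [i1|i1] := eqVneq i k.-1; have [j1|j1] := eqVneq j k.-1;
have [l1|l1] := eqVneq l k.-1; rewrite ?orbT /=; try (exfalso; lia).
- case: path_labP => *; case: ifP => *; case: ifP => * //; exfalso; lia.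
- case: path_labP => *; case: ifP => *; case: ifP => * //; exfalso; lia.
- case: path_labP => *; case: ifP => *; case: ifP => * //; exfalso; lia.
- exact: path_triple.
Qed.

Lemma diagram_triple k M i j l : finite_conn_diagram k M ->
  i < k -> j < k -> l < k -> i != j -> i != l -> j != l ->
  spherical_triple (M i j) (M i l) (M j l).
Proof.
rewrite /finite_conn_diagram.
case=> [[_ ->]|[[_ ->]|[[h ->]|[[h ->]|[[-> ->]|[[-> ->]|[[h ->]|[-> [p [hp _ ->]]]]]]]]]].
- by move=> *; apply: path_triple.
- by move=> *; apply: path_triple.
- exact: typeD_triple.
- by apply: finite_triple; move: h; rewrite !inE => /or3P[] /eqP->; vm_compute.
- by apply: finite_triple; vm_compute.
- by apply: finite_triple; vm_compute.
- by apply: finite_triple; case: h => ->; vm_compute.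
(* A diagram of type [I_2(p)] has no three distinct vertices. *)
- lia.
Qed.

(** * Weights on the connected diagrams *)

(* [e x z]: the letter [z] may follow [x] in a normal word. *)
Definition weighted (T : finType) (e : rel T) (y : T -> nat) : Prop :=
  forall x, \sum_(z | e x z) y z < 4 * y x.

Definition diagram_weighted (k : nat) (M : nat -> nat -> nat) : Prop :=
  exists r y : nat -> nat, forall j, j < k ->
    \sum_(i < k | (r j <= r i) || (M j i != 2)) y i < 4 * y j.

(* The last vertex carries more than half of the total weight; this is what
   allows another vertex to be attached to it. *)
Definition rooted_weights (adj : rel nat) (k : nat) (y : nat -> nat) : Prop :=
  (forall j, j < k -> \sum_(i < k.+1 | (i <= j) || adj j i) y i < 4 * y j) /\
  2 * (\sum_(i < k) y i) < \sum_(i < k.+1) y i.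

(** Old weights are doubled, and the new vertex gets one more than their new total [2 * Y]. The
    inequalities at [j < k] just double; at [k] even the full total [4 * Y + 1] is below [8 * y k],
    since [y k] exceeds half of [Y]. *)
Lemma rooted_weights_extend (adj : rel nat) k y :
  (forall j, j < k -> ~~ adj j k.+1) ->
  rooted_weights adj k y -> exists y', rooted_weights adj k.+1 y'.
Proof.
move=> hadj [h1 h2].
pose Y := \sum_(i < k.+1) y i.
pose y' i := if i == k.+1 then (2 * Y).+1 else 2 * y i.
have hy' (P : pred nat) l : l <= k.+1 ->
    \sum_(i < l | P i) y' i = 2 * \sum_(i < l | P i) y i.
  move=> hl; rewrite big_distrr /=; apply: eq_bigr => i _.
  by rewrite /y' ifN // neq_ltn (leq_trans (ltn_ord i)).
have y'l : y' k.+1 = (2 * Y).+1 by rewrite /y' eqxx.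
have y'S j : j <= k -> y' j = 2 * y j by move=> hj; rewrite /y' ifN // neq_ltn ltnS hj.
have tot : \sum_(i < k.+1) y' i = 2 * Y by rewrite (hy' predT).
have tot' : \sum_(i < k.+2) y' i = 2 * Y + (2 * Y).+1.
  by rewrite big_ord_recr /= tot y'l.
exists y'; split; last by rewrite tot tot'; lia.
move=> j; rewrite ltnS leq_eqVlt => /predU1P[->|hj].
  apply: (@leq_ltn_trans (2 * Y + (2 * Y).+1)).
    by rewrite -tot' big_mkcond leq_sum // => i _; case: ifP.
  rewrite y'S //; move: h2; rewrite -/Y /Y big_ord_recr /=; lia.
rewrite big_mkcond big_ord_recr /= -big_mkcond (hy' (fun i => (i <= j) || adj j i)) //.
have -> : (k < j) = false by lia.
rewrite (negPf (hadj _ hj)) addn0 y'S; last exact: ltnW.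
by have := h1 _ hj; lia.
Qed.

Lemma rooted_weights_chain (adj : rel nat) b y :
  (forall j l, b <= l -> j < l -> ~~ adj j l.+1) ->
  rooted_weights adj b y -> forall k, b <= k -> exists y', rooted_weights adj k y'.
Proof.
move=> hadj h k; elim: k => [|k IH].
  by rewrite leqn0 => /eqP E; exists y; rewrite -E.
rewrite leq_eqVlt => /predU1P[<-|hb]; first by exists y.
have [y' h'] := IH hb.
by apply: rooted_weights_extend h' => j; apply: hadj.
Qed.

(** Adds the inequality at the root [k], where the total weight is below [2 * y k]. *)
Lemma rooted_weights_bound (adj : rel nat) k y : rooted_weights adj k y ->
  forall j, j < k.+1 -> \sum_(i < k.+1 | (i <= j) || adj j i) y i < 4 * y j.
Proof.
move=> [h1 h2] j; rewrite ltnS leq_eqVlt => /predU1P[->|]; last exact: h1.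
have : \sum_(i < k.+1 | (i <= k) || adj k i) y i <= \sum_(i < k.+1) y i.
  by rewrite big_mkcond leq_sum // => i _; case: ifP.
move: h2; rewrite !big_ord_recr /=; lia.
Qed.

Lemma sum_rel_mono k (P Q : pred nat) (y : nat -> nat) :
  (forall i, i < k -> P i -> Q i) -> \sum_(i < k | P i) y i <= \sum_(i < k | Q i) y i.
Proof.
move=> h; rewrite big_mkcond [X in _ <= X]big_mkcond leq_sum // => i _.
by case: ifP => // /h->.
Qed.

Lemma path_weighted k M : 0 < k ->
  (forall j i, j < k -> i < k -> i != j -> M j i != 2 -> (i == j.+1) || (j == i.+1)) ->
  diagram_weighted k M.
Proof.
case: k => // k _ hM; pose adj j i := i == j.+1.
have h0 : rooted_weights adj 0 (fun=> 1) by split; rewrite // !big_ord_recr !big_ord0.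
have [|y /rooted_weights_bound hy] := rooted_weights_chain _ h0 (leq0n k).
  by move=> j l _ jl; rewrite /adj eqSS neq_ltn jl orbT.
(* This rank reverses the numbering, so [r j <= r i] becomes [i <= j]. *)
exists (fun i => k - i), y => j hj; apply: leq_ltn_trans (hy _ hj).
apply: (@sum_rel_mono _ (fun i => (k - j <= k - i) || (M j i != 2))
  (fun i => (i <= j) || adj j i)) => i hi.
have [//|ij] := leqP i j; rewrite /adj /= => /orP[|h]; first lia.
by have := hM _ _ hj hi _ h; lia.
Qed.

(* Numbered backwards, [D_k] is the chain 2, 3, ... with the two leaves 0 and 1 attached to 2. *)
Lemma typeD_weighted k : 4 <= k -> diagram_weighted k (typeD k).
Proof.
case: k => // k hk; pose adj j i := (i == j.+1) && (0 < j) || (j == 0) && (i == 2).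
(* The conditions on these values are [11 + 30 < 4 * 11], [11 + 14 + 30 < 4 * 14] and
   [2 * (11 + 14) < 11 + 14 + 30]. *)
pose y0 i := nth 0 [:: 11; 14; 30] i.
have h0 : rooted_weights adj 2 y0.
  split; last by rewrite !big_ord_recr !big_ord0.
  by case=> [|[|]] // _; rewrite big_mkcond !big_ord_recr big_ord0.
have [||y /rooted_weights_bound hy] := rooted_weights_chain _ h0 (_ : 2 <= k).
- by move=> j l; rewrite /adj; lia.
- by lia.
exists id, (fun i => y (k - i)) => j hj.
have hj' : k - j < k.+1 by lia.
apply: leq_ltn_trans (hy _ hj').
rewrite [X in _ <= X](reindex_inj rev_ord_inj) /=.
under [X in _ <= X]eq_bigr do rewrite subSS.
apply: (@sum_rel_mono _ (fun i => (j <= i) || (typeD k.+1 j i != 2))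
  (fun i => (k.+1 - i.+1 <= k - j) || adj (k - j) (k.+1 - i.+1)) (fun i => y (k - i))) => i hi.
case/orP=> [|]; first lia.
rewrite /typeD /adj; case: ifP => h; first by case: ifP => h' // _; lia.
by case: path_labP => // *; lia.
Qed.

(* Rooted at the end of the long arm. The values around the branch vertex perturb the
   solution (1/8, 3/8, 1/2, 1) of the equality case; each further value is nearly the
   largest one the previous vertex allows. [y] serves E6, E7 and E8 at once. *)
Lemma typeE_weighted k : k \in [:: 6; 7; 8] -> diagram_weighted k (typeE k).
Proof.
move=> hk.
pose r i := if i == k.-1 then 5 else nth 0 [:: 7; 6; 4; 3; 2; 1; 0] i.
pose y i := if i == k.-1 then 501 else nth 0 [:: 126; 376; 1000; 1996; 3984; 7952; 15872] i.
exists r, y => j hj.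
rewrite -(big_mkord (fun i => (r j <= r i) || (typeE k j i != 2)) y).
rewrite -big_filter -(big_map y predT id) -sumnE.
have: j \in iota 0 k by rewrite mem_iota.
move: j {hj}; apply/allP.
by rewrite /r /y; move: hk {r y}; rewrite !inE => /or3P[] /eqP->; vm_compute.
Qed.

Lemma diagram_weights k M : finite_conn_diagram k M -> diagram_weighted k M.
Proof.
rewrite /finite_conn_diagram.
case=> [[h ->]|[[h ->]|[[h ->]|[[h ->]|[[-> ->]|[[-> ->]|[[h ->]|[-> [p [hp _ ->]]]]]]]]]].
- by apply: path_weighted => // j i _ _ _; rewrite /typeA; case: path_labP => // *; lia.
- by apply: path_weighted => [|j i _ _ _]; [lia|rewrite /typeB; case: path_labP => // *; lia].
- exact: typeD_weighted.
- exact: typeE_weighted.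
- apply: path_weighted => // j i _ _ _; rewrite /typeF4; case: ifP => [*|_]; first lia.
  by case: path_labP => // *; lia.
- by apply: path_weighted => // j i _ _ _; rewrite /typeI; case: path_labP => // *; lia.
- by apply: path_weighted => [|j i _ _ _]; [lia|rewrite /typeH; case: path_labP => // *; lia].
- by apply: path_weighted => // j i _ _ _; rewrite /typeI; case: path_labP => // *; lia.
Qed.

(** * From connected components to the whole Coxeter graph *)

Section Spherical.

Variables (n : nat) (m : 'I_n -> 'I_n -> nat).
Hypothesis sph : spherical m.

Lemma spherical_pair i j : i != j -> m i j = m j i /\ 2 <= m i j.
Proof.
move=> ij; have [p [c [hc hq]]] := sph.
have [cij|cij] := eqVneq (c i) (c j); last first.
  by rewrite (hc _ _ cij) hc 1?eq_sym.
have [k [f [M [f_inj fc dM mM]]]] := hq (c j).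
have [a fa] := (fc i).1 cij; have [b fb] := (fc j).1 erefl.
have ab : a != b by apply: contra_neq ij => ab; rewrite -fa -fb ab.
have ba : b != a by rewrite eq_sym.
rewrite -fa -fb !mM //; split; [exact: diagram_sym dM|exact: diagram_ge2 dM].
Qed.

Lemma spherical_labels a b c : uniq [:: a; b; c] ->
  spherical_triple (m a b) (m a c) (m b c).
Proof.
rewrite /= !inE negb_or andbT => /andP[/andP[ab ac] bc].
have [p [cl [hc hq]]] := sph; rewrite /spherical_triple.
(* Unless all three vertices lie in one component, at least two labels are 2. *)
have [eab|nab] := eqVneq (cl a) (cl b); last first.
  rewrite (hc _ _ nab) /=; have [eac|nac] := eqVneq (cl a) (cl c); last by rewrite hc.
  by rewrite (hc b c) ?orbT // -eac eq_sym.
have [eac|nac] := eqVneq (cl a) (cl c); last first.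
  by rewrite (hc a c) // (hc b c) ?orbT //= -?eab // ?orbT.
have [k [f [M [f_inj fc dM mM]]]] := hq (cl a).
have [i fi] := (fc a).1 erefl; have [j fj] := (fc b).1 (esym eab).
have [l fl] := (fc c).1 (esym eac).
have ij : i != j by apply: contra_neq ab => e; rewrite -fi -fj e.
have il : i != l by apply: contra_neq ac => e; rewrite -fi -fl e.
have jl : j != l by apply: contra_neq bc => e; rewrite -fj -fl e.
by rewrite -fi -fj -fl !mM //; apply: (diagram_triple dM).
Qed.

Lemma component_weights p (c : 'I_n -> 'I_p) q :
  (exists (k : nat) (f : 'I_k -> 'I_n) (M : nat -> nat -> nat),
      [/\ injective f,
          (forall i, c i = q <-> exists a, f a = i),
          finite_conn_diagram k M &
          forall a b : 'I_k, a != b -> m (f a) (f b) = M a b]) ->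
  exists ry : ('I_n -> nat) * ('I_n -> nat), forall j, c j = q ->
    \sum_(i | (c i == q) && ((ry.1 j <= ry.1 i) || (m j i != 2))) ry.2 i < 4 * ry.2 j.
Proof.
move=> [k [f [M [f_inj fc dM mM]]]].
have [r [y ry]] := diagram_weights dM.
(* The default [0] is taken only outside the component, where no value enters the claim. *)
pose lift (g : nat -> nat) i := if [pick a | f a == i] is Some a then g a else 0.
have liftE g a : lift g (f a) = g a.
  by rewrite /lift; case: pickP => [b /eqP/f_inj -> //|/(_ a)/=]; rewrite eqxx.
exists (lift r, lift y) => j /fc[a <-] /=; rewrite !liftE.
apply: leq_ltn_trans (ry a (ltn_ord a)).
rewrite (eq_bigl (fun i => (i \in f @: setT) && ((r a <= lift r i) || (m (f a) i != 2))));
  last first.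
  move=> i; congr (_ && _); apply/eqP/imsetP => [/fc[b <-]|[b _ ->]]; first by exists b; rewrite ?inE.
  by apply/fc; exists b.
rewrite big_imset_cond /=; last by move=> ? ? _ _; apply: f_inj.
rewrite big_mkcond [X in _ <= X]big_mkcond; apply: leq_sum => b _.
rewrite in_setT /= !liftE; case: ifP => // h; rewrite ifT //.
have [ab|ab] := eqVneq a b; first by rewrite ab leqnn.
by rewrite -mM.
Qed.

(** Letters of different components commute, so they can be sorted by component first, via the rank
    [c i * B + r0 i]. After a letter then come letters of its own component or any letter of a later
    one. *)
Lemma spherical_weights : exists r y : 'I_n -> nat,
  weighted (fun j i => (r j <= r i) || (m j i != 2)) y.
Proof.
have [p [c [hc hq]]] := sph.
have /choice[ry hry] := fun q => component_weights (hq q).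
pose r0 i := (ry (c i)).1 i; pose y0 i := (ry (c i)).2 i.
have h0 j : \sum_(i | (c i == c j) && ((r0 j <= r0 i) || (m j i != 2))) y0 i < 4 * y0 j.
  have := hry (c j) j erefl; rewrite -/(y0 j); apply: leq_ltn_trans.
  rewrite [X in _ <= X](eq_bigr y0) ?eq_leq //.
    by apply: eq_bigl => i; rewrite /r0; case: eqP => // ->.
  by move=> i /andP[/eqP ci _]; rewrite /y0 ci.
pose K := (\sum_i y0 i).+1; pose B := (\sum_i r0 i).+1.
have r0B i : r0 i < B by rewrite /B ltnS (bigD1 i) //= leq_addr.
exists (fun i => c i * B + r0 i), (fun i => y0 i * K ^ (p - c i)) => j.
(* A factor [K] between consecutive components makes the later ones negligible. *)
apply: (@leq_ltn_trans (\sum_(i | (c i == c j) && ((r0 j <= r0 i) || (m j i != 2))) y0 i *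
     K ^ (p - c j) + \sum_(i | c j < c i) y0 i * K ^ (p - (c j).+1))).
  rewrite big_mkcond [leqRHS](f_equal2 addn (big_mkcond _ _) (big_mkcond _ _)) -big_split /=.
  apply: leq_sum => i _; case: ifP => // h.
  have [e|ne] := eqVneq (c i) (c j).
    by rewrite /= ifT ?e ?leq_addr //; move: h; rewrite e leq_add2l.
  have mij : m j i = 2 by apply: hc; rewrite eq_sym.
  have cji : c j < c i.
    move: h; rewrite mij orbF ltnNge; apply: contraL => cij.
    have {cij} : c i < c j by rewrite ltn_neqAle cij andbT.
    by rewrite -ltnNge; have := r0B i; nia.
  by rewrite /= cji add0n leq_mul2l leq_pexp2l ?orbT //; lia.
rewrite -!big_distrl /=; set S := bigop _ _ _; set T := bigop _ _ _.
have hS : S < 4 * y0 j by exact: h0.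
have hT : T < K by rewrite /K ltnS /T big_mkcond leq_sum // => i _; case: ifP.
have -> : p - c j = (p - (c j).+1).+1 by have := ltn_ord (c j); lia.
have := expn_gt0 K (p - (c j).+1); rewrite expnS /= => E0.
(* As [S < 4 * y0 j] holds in integers, a whole unit is left over, and it covers [T < K]. *)
apply: (@leq_trans (S * (K * K ^ (p - (c j).+1)) + K * K ^ (p - (c j).+1))).
  by rewrite ltn_add2l ltn_pmul2r.
by rewrite -mulSnr [leqRHS]mulnA leq_mul2r hS orbT.
Qed.

End Spherical.

(** * Counting paths by weights *)

Section Counting.

Variables (T : finType) (e : rel T) (y : T -> nat).

Lemma card_pathS k x : #|[set w : k.+1.-tuple T | path e x w]| =
  \sum_(z | e x z) #|[set w : k.-tuple T | path e z w]|.
Proof.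
rewrite -sum1_card (reindex (fun p : T * k.-tuple T => [tuple of p.1 :: p.2])) /=; last first.
  exists (fun w => (thead w, [tuple of behead w])) => [[z w] _|w _] /=.
    by congr (_, _); apply/val_inj.
  by rewrite -tuple_eta.
under [RHS]eq_bigr do rewrite -sum1_card.
by rewrite pair_big_dep; apply: eq_bigl => -[z w]; rewrite !inE.
Qed.

(** The weights after [x] sum to at most [4 * y x - 1], which is at most [(4 - 1/M) * y x] because
    [y x <= M]. Iterating, with denominators cleared, gives the bound; it starts from [1 <= y x]. *)
Lemma card_path_bound M k x : weighted e y -> (forall z, y z <= M) ->
  M ^ k * #|[set w : k.-tuple T | path e x w]| <= (4 * M).-1 ^ k * y x.
Proof.
move=> ey yM; have y0 z : 0 < y z by have := ey z; lia.
elim: k x => [|k IH] x.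
  rewrite !mul1n; apply: leq_trans (y0 x).
  by apply: leq_trans (max_card _) _; rewrite card_tuple.
rewrite card_pathS expnS -mulnA big_distrr /=.
apply: (@leq_trans (M * \sum_(z | e x z) ((4 * M).-1 ^ k * y z))).
  by rewrite leq_mul2l leq_sum ?orbT // => z _; apply: IH.
rewrite -big_distrr /= mulnCA expnS mulnAC [leqRHS]mulnC leq_mul2l; apply/orP; right.
have := ey x; have := yM x; have := y0 x; nia.
Qed.

End Counting.

(** * From an exponential bound to the growth rate *)

Section Growth.

Import Order.TTheory GRing.Theory Num.Theory.
Local Open Scope classical_set_scope.
Local Open Scope ring_scope.

Lemma limn_esup_le (R : realType) (u : (\bar R)^nat) (N : nat) (l : \bar R) :
  (forall k, (N <= k)%N -> (u k <= l)%E) -> (limn_esup u <= l)%E.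
Proof.
move=> h; apply: le_trans (ereal_inf_lbound _) (_ : ereal_sup (u @` [set k | (N <= k)%N]) <= l)%E.
  by exists [set k | (N <= k)%N] => //; exists N.
by apply: ge_ereal_sup => _ [k /= Nk <-]; apply: h.
Qed.

Lemma growth_rate_lt (s : nat -> nat) (C L M b : nat) :
  (0 < M)%N -> (M <= L)%N -> (L < b * M)%N ->
  (forall k, (M ^ k * s k <= L ^ k * C)%N) ->
  (growth_rate s < (b%:R : Rdefinitions.R)%:E)%E.
Proof.
move=> M0 ML Lb h; set R := Rdefinitions.R.
(* A rate [c] strictly between [t] and [b] leaves room to absorb the constant [C]. *)
pose t : R := L%:R / M%:R; pose c : R := (t + b%:R) / 2.
have M0r : 0 < M%:R :> R by rewrite ltr0n.
have t1 : 1 <= t by rewrite /t ler_pdivlMr // mul1r ler_nat.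
have tb : t < b%:R by rewrite /t ltr_pdivrMr // -natrM ltr_nat.
have [tc cb] : t < c /\ c < b%:R by rewrite /c; lra.
have lntc : 0 < ln c - ln t by rewrite subr_gt0 ltr_ln ?posrE; lra.
(* From [N] on, [C.+1] is at most [(c / t) ^ k]; the successor also keeps [k] positive. *)
pose N := (Num.trunc (ln (C.+1)%:R / (ln c - ln t))).+1.
apply: (@le_lt_trans _ _ c%:E); last by rewrite lte_fin.
apply: (@limn_esup_le _ _ N) => k Nk; rewrite lee_fin.
have k0 : 0 < k%:R :> R by rewrite ltr0n (leq_trans _ Nk).
rewrite -[leRHS]lnK ?posrE; last by lra.
rewrite ler_expR ler_pdivrMr //.
(* For [s k = 0] the convention [ln 0 = 0] makes the term [1], which [c > t >= 1] bounds. *)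
have [->|sk] := posnP (s k).
  by rewrite ln0 // mulr_ge0 ?ln_ge0 ?ler0n //; lra.
have hC : ln C.+1%:R <= k%:R * (ln c - ln t).
  rewrite -ler_pdivrMr //; apply: ltW; apply: lt_le_trans (_ : N%:R <= _); last by rewrite ler_nat.
  exact: truncnS_gt.
have hs : (s k)%:R <= t ^+ k * C.+1%:R :> R.
  rewrite expr_div_n mulrAC ler_pdivlMr ?exprn_gt0 // -!natrX -!natrM ler_nat mulnC.
  by apply: leq_trans (h k) _; rewrite leq_mul2l leqnSn orbT.
have : ln (s k)%:R <= ln (t ^+ k * C.+1%:R).
  by rewrite ler_ln ?posrE ?mulr_gt0 ?exprn_gt0 ?ltr0n //; lra.
rewrite lnM ?posrE ?exprn_gt0 ?ltr0n //; last by lra.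
rewrite lnXn; last by lra.
rewrite -mulr_natl; lra.
Qed.

End Growth.

(** * Normal forms of positive words and of group elements *)

Section NormalForms.

Variables (n : nat) (m : 'I_n -> 'I_n -> nat).

Section PositiveWords.

Variable r : 'I_n -> nat.
Hypothesis msym : forall i j, i != j -> m i j = m j i.
Hypothesis mge2 : forall i j, i != j -> 2 <= m i j.

Definition follows (j i : 'I_n) : bool := (r j <= r i) || (m j i != 2).

(** Each rank is multiplied by the number of letters from there to the end, so moving a higher rank
    to the right lowers the sum. *)
Fixpoint disorder (w : seq 'I_n) : nat :=
  if w is x :: w' then r x * (size w').+1 + disorder w' else 0.

Lemma disorder_cat u v v' : size v = size v' -> disorder v' < disorder v ->
  disorder (u ++ v') < disorder (u ++ v).
Proof. by move=> sv h; elim: u => //= x u IH; rewrite !size_cat sv ltn_add2l. Qed.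

Lemma not_sorted_split (T : Type) (e : rel T) s : ~~ sorted e s ->
  exists u x z v, s = u ++ x :: z :: v /\ ~~ e x z.
Proof.
elim: s => // x [//|z s] IH; rewrite [sorted _ _]/= negb_and => /orP[exz|/IH].
  by exists [::], x, z, s.
by move=> [u [x' [z' [v [-> h]]]]]; exists (x :: u), x', z', v.
Qed.

(** An adjacent pair that violates [follows] commutes and has decreasing ranks; swapping it lowers
    [disorder]. *)
Lemma positive_normal_form w : exists w',
  [/\ size w' = size w, sorted follows w' & monoid_eq m w w'].
Proof.
have [N] := ubnP (disorder w); elim: N w => // N IH w wN.
have [sw|/not_sorted_split[u [j [i [v [Ew]]]]]] := boolP (sorted follows w).
  by exists w; split => //; apply: ME_refl.
rewrite [follows _ _]/follows negb_or -ltnNge negbK => /andP[rij /eqP mji].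
have ji : j != i by apply: contraTneq rij => ->; rewrite ltnn.
have [|w' [sw' fw' ew']] := IH (u ++ i :: j :: v).
  apply: (@leq_trans (disorder w)) => //; rewrite Ew; apply: disorder_cat => //=.
  rewrite !addnA ltn_add2r !mulnS; lia.
exists w'; split => //; first by rewrite sw' Ew !size_cat.
apply: ME_trans ew'; rewrite Ew; apply: monoid_eq_cat2l; exact: swap_comm.
Qed.

End PositiveWords.

Local Notation "u =~ v" := (group_eq m u v) (at level 70).

Lemma group_eq_cat2l w u v : u =~ v -> w ++ u =~ w ++ v.
Proof.
elim=> [u1|u1 u2 _|u1 u2 u3 _ + _|u1 v1 u2 v2 h]; [exact: GE_refl|exact: GE_sym|exact: GE_trans|].
by rewrite catA [X in _ =~ X]catA; apply: GE_ctx.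
Qed.

Lemma group_eq_cat2r w u v : u =~ v -> u ++ w =~ v ++ w.
Proof.
elim=> [u1|u1 u2 _|u1 u2 u3 _ + _|u1 v1 u2 v2 h]; [exact: GE_refl|exact: GE_sym|exact: GE_trans|].
by rewrite -!catA; apply: GE_ctx.
Qed.

Lemma pos_cat (u v : seq 'I_n) : pos (u ++ v) = pos u ++ pos v.
Proof. exact: map_cat. Qed.

Lemma group_eq_pos u v : monoid_eq m u v -> pos u =~ pos v.
Proof.
elim=> [u1|u1 u2 _|u1 u2 u3 _ + _|u1 v1 u2 v2 h]; [exact: GE_refl|exact: GE_sym|exact: GE_trans|].
by rewrite !pos_cat; apply: GE_ctx; apply: GRel.
Qed.

Lemma ginv_letterK : involutive (@ginv_letter n).
Proof. by case=> i b; rewrite /ginv_letter /= negbK. Qed.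

Lemma group_mulV (w : gword n) : w ++ ginv w =~ [::].
Proof.
elim: w => [|a w IH]; first exact: GE_refl.
have -> : (a :: w) ++ ginv (a :: w) = [:: a] ++ (w ++ ginv w) ++ [:: ginv_letter a].
  by rewrite /ginv map_cons rev_cons -cats1 /= !catA.
apply: GE_trans (group_eq_cat2l _ (group_eq_cat2r _ IH)) _.
exact: (@GE_ctx _ m [::] [::] _ _ (GCancel m a)).
Qed.

Lemma group_mulVl (w : gword n) : ginv w ++ w =~ [::].
Proof.
have {2}-> : w = ginv (ginv w); last exact: group_mulV.
by rewrite /ginv map_rev revK -map_comp map_id_in // => a _; apply: ginv_letterK.
Qed.

Variable D : seq 'I_n.

Definition nabla_pow (a : nat) : gword n := flatten (nseq a (ginv (pos D))).

Hypothesis D_central : forall i, exists j, monoid_eq m (rcons D i) (j :: D).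

Lemma nabla_swap i : exists j, pos [:: i] ++ ginv (pos D) =~ ginv (pos D) ++ pos [:: j].
Proof.
have [j /group_eq_pos] := D_central i; rewrite -cats1 -cat1s !pos_cat => h; exists j.
have h1 := group_eq_cat2r (pos [:: i] ++ ginv (pos D)) (group_mulVl (pos D)).
apply: GE_trans (GE_sym h1) _; rewrite -catA; apply: group_eq_cat2l.
rewrite catA; apply: GE_trans (group_eq_cat2r _ h) _.
exact: (group_eq_cat2l (pos [:: j]) (group_mulV (pos D))).
Qed.

Lemma nabla_pow_swap a i : exists j, pos [:: i] ++ nabla_pow a =~ nabla_pow a ++ pos [:: j].
Proof.
elim: a i => [|a IH] i; first by exists i; apply: GE_refl.
have [j hj] := nabla_swap i; have [l hl] := IH j; exists l.
rewrite -[nabla_pow a.+1]/(ginv (pos D) ++ nabla_pow a) catA; apply: GE_trans (group_eq_cat2r _ hj) _.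
by rewrite -!catA; apply: group_eq_cat2l.
Qed.

(** Moving a generator past powers of [nabla] may change the generator but not the number of
    letters. *)
Lemma collect_nabla (w : seq 'I_n.+1) : exists a p, size w = a + size p /\
  eval_word D w =~ nabla_pow a ++ pos p.
Proof.
elim: w => [|x w [a [p [sw ew]]]]; first by exists 0, [::]; split=> //; apply: GE_refl.
rewrite /eval_word /= -/(eval_word D w) /eval_letter.
case: insubP => [i _ _|_].
  have [j hj] := nabla_pow_swap a i; exists a, (j :: p); rewrite /= sw addnS; split => //.
  apply: GE_trans (group_eq_cat2l [:: (i, false)] ew) _.
  rewrite catA; apply: GE_trans (group_eq_cat2r _ hj) _; rewrite -catA; exact: GE_refl.
exists a.+1, p; rewrite /= sw; split => //.
by rewrite /nabla_pow /= -catA; apply: group_eq_cat2l.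
Qed.

Definition letter (i : 'I_n) : 'I_n.+1 := widen_ord (leqnSn n) i.

Lemma insub_letter i : insub (letter i : nat) = Some i :> option 'I_n.
Proof. exact: valK. Qed.

Lemma insub_nabla : insub (@ord_max n : nat) = None :> option 'I_n.
Proof. by rewrite insubF //= ltnn. Qed.

Lemma eval_nabla_pos a p : eval_word D (nseq a ord_max ++ map letter p) = nabla_pow a ++ pos p.
Proof.
rewrite /eval_word map_cat flatten_cat map_nseq; congr (flatten (nseq _ _) ++ _).
  by rewrite /eval_letter insub_nabla.
by elim: p => //= i p ->; rewrite /eval_letter insub_letter.
Qed.

(* [nabla] commutes with the other letters up to a permutation of them, and sorts first. *)
Definition group_follows r (a b : 'I_n.+1) : bool :=
  match insub (a : nat) : option 'I_n, insub (b : nat) : option 'I_n with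
  | None, _ => true
  | Some _, None => false
  | Some j, Some i => follows r j i
  end.

Lemma path_nabla_pos r a p : sorted (follows r) p ->
  path (group_follows r) ord_max (nseq a ord_max ++ map letter p).
Proof.
move=> sp; have hn x : group_follows r ord_max x by rewrite /group_follows insub_nabla.
elim: a => [|a IH] /=; last by rewrite hn.
case: p sp => //= i p; rewrite hn path_map.
by rewrite (@eq_path _ _ (follows r)) // => j l; rewrite /group_follows /= !insub_letter.
Qed.

Hypothesis msym : forall i j, i != j -> m i j = m j i.
Hypothesis mge2 : forall i j, i != j -> 2 <= m i j.

Lemma group_normal_form r (w : seq 'I_n.+1) : exists w',
  [/\ size w' = size w, path (group_follows r) ord_max w' &
      eval_word D w =~ eval_word D w'].
Proof.
have [a [p [sw ew]]] := collect_nabla w.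
have [p' [sp fp ep]] := positive_normal_form r msym mge2 p.
exists (nseq a ord_max ++ map letter p'); split; last rewrite eval_nabla_pos.
- by rewrite size_cat size_nseq size_map sp sw.
- exact: path_nabla_pos.
- by apply: GE_trans ew (group_eq_cat2l _ _); apply: group_eq_pos.
Qed.

(** Normal forms keep the length, so every counted class is the class of a path of length [k].
    Starting at [ord_max], which is [nabla], leaves the first letter free. *)
Lemma growth_count_le r k :
  growth_count m D k <= #|[set w : k.-tuple 'I_n.+1 | path (group_follows r) ord_max w]|.
Proof.
rewrite /growth_count; set cls := (fun w : k.-tuple _ => _).
apply: leq_trans (leq_imset_card cls _); apply: subset_leq_card.
apply/fintype.subsetP => _ /imsetP[w _ ->].
have [w' [sw' pw' ew']] := group_normal_form r w.
have sw : size w' == k by rewrite sw' size_tuple.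
apply/imsetP; exists (Tuple sw); rewrite ?inE //.
apply/setP => v; rewrite !inE; apply/asboolP/asboolP => /= h.
  exact: GE_trans (GE_sym ew') h.
exact: GE_trans ew' h.
Qed.

(** No generator is followed by [nabla], so the old inequalities persist. With [Y] the old total,
    [nabla] weighs [Y + 1], and [Y + (Y + 1) < 4 * (Y + 1)]. *)
Lemma group_weighted r y : weighted (follows r) y ->
  weighted (group_follows r)
    (fun a => if insub (a : nat) is Some i then y i else (\sum_i y i).+1).
Proof.
move=> h x; rewrite big_mkcond big_ord_recr /=.
under eq_bigr do rewrite insub_letter.
rewrite insub_nabla /group_follows insub_nabla.
under eq_bigr do rewrite insub_letter.
case: insub => [j|]; last by rewrite /=; lia.
by rewrite -big_mkcond addn0.
Qed.

End NormalForms.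

Theorem theorem2 (n : nat) (m : 'I_n -> 'I_n -> nat) (D : seq 'I_n) :
  (0 < n)%N -> spherical m -> is_garside m D ->
  (growth_rate (growth_count m D) < (4%:R : Rdefinitions.R)%:E)%E.
Proof.
move=> _ sph gD.
have msym i j : i != j -> m i j = m j i by case/(spherical_pair sph).
have mge2 i j : i != j -> 2 <= m i j by case/(spherical_pair sph).
have D_central i : exists j, monoid_eq m (rcons D i) (j :: D).
  by apply: artin_garside_quasi_central => // a b c; apply: spherical_labels.
have [r [y /group_weighted]] := spherical_weights sph; set z := fun a => _ => hz.
pose M := \sum_a z a.
have zM a : z a <= M by rewrite /M (bigD1 a) //= leq_addr.
have M0 : 0 < M by apply: leq_trans (zM ord_max); have := hz ord_max; lia.
(* The paths start at [nabla] and grow at most at the rate [(4 * M - 1) / M], below 4. *)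
apply: (@growth_rate_lt _ (z ord_max) (4 * M).-1 M) => [//| | |k]; [lia|lia|].
apply: leq_trans (card_path_bound k ord_max hz zM).
by rewrite leq_mul2l (growth_count_le D_central) ?orbT.
Qed.
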